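(* Let $(u^k,v^k,w^k,\Lambda^k)_{k\ge 0}$ be the sequence generated by the BCA algorithm (defined in the context, run without termination) with parameters $\lambda_1,\lambda_2,\alpha,\epsilon>0$ and data $f\in\mathbb{R}^n$. Assume that there is a constant $c>0$, independent of $k$, such that $w_i^k\ge c$ for all $i\in\{1,\dots,n\}$ and all $k$, and that $$\alpha>\max\left(\frac{\sqrt{2}\,\lambda_2}{c^2\epsilon},\ \lambda_2\Big(\frac1c-1\Big)^2\right).$$ Then: (1) The sequence $(u^k,v^k,w^k,\Lambda^k)$ is bounded and has at least one limit point. (2) $u^{k+1}-u^k\to 0$, $v^{k+1}-v^k\to 0$, $w^{k+1}-w^k\to 0$ and $\Lambda^{k+1}-\Lambda^k\to 0$ as $k\to+\infty$. (3) Each limit point $(u^*,v^*,w^*,\Lambda^* )$ of the sequence is a stationary point of $L_\alpha(u,v,w,\Lambda)$, and $(u^*,v^* )$ is a stationary point of $H(u,v)$.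
   Context: All vectors are in $\mathbb{R}^n$ and $\Vert\cdot\Vert$, $\langle\cdot,\cdot\rangle$ are the Euclidean norm and inner product. $\circ$ denotes element-wise multiplication; divisions, squares, logarithms, square roots and maxima of vectors are element-wise; $\mathbf 1$ is the all-ones vector and $\mathbf 0$ the zero vector. $\nabla$ is the discrete (finite difference) gradient, a linear operator with $\nabla u_i\in\mathbb{R}^2$ its value at pixel $i$, and $|\nabla u_i|$ is the Euclidean norm of that vector. Let $\mathcal V=\{v\in\mathbb{R}^n: v_i\ge\epsilon\ \forall i\}$ with $\epsilon>0$, and let $\chi_{\mathcal V}(v)=0$ if $v\in\mathcal V$, $+\infty$ otherwise. The TV-IC functional is $$H(u,v)=\frac{\lambda_1}{2}\sum_i(f_i-v_i)^2+\lambda_2\sum_i\Big(u_i-v_i\ln\frac{u_i}{v_i}-v_i\Big)+\sum_i|\nabla u_i|+\chi_{\mathcal V}(v)$$ (considered for $u_i>0$, $v_i>0$). The augmented Lagrangian is, for $w_i>0$, $$L_\alpha(u,v,w,\Lambda)=\frac{\lambda_1}{2}\sum_i(f_i-v_i)^2+\sum_i|\nabla u_i|+\chi_{\mathcal V}(v)+\lambda_2\sum_i(u_i-v_i\ln w_i-v_i)+\langle\Lambda,v\circ w-u\rangle+\frac{\alpha}{2}\Vert v\circ w-u\Vert^2 .$$ BCA algorithm: initialize $u^0=f$, $v^0=f$, $w^0=\mathbf 1$, $\Lambda^0=\mathbf 0$; for $k=0,1,2,\dots$ compute $$u^{k+1}=\operatorname*{argmin}_u L_\alpha(u,v^k,w^k,\Lambda^k)=\operatorname*{argmin}_u\Big\{\frac{\alpha}{2}\Big\Vert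 v^k\circ w^k+\frac{\Lambda^k}{\alpha}-\frac{\lambda_2\mathbf 1}{\alpha}-u\Big\Vert^2+\sum_i|\nabla u_i|\Big\},$$ $$v^{k+1}=\max\Big(\epsilon\mathbf 1,\ \frac{\lambda_1 f+\lambda_2\ln w^k+\alpha w^k\circ u^{k+1}}{\lambda_1\mathbf 1+\alpha (w^k)^2}\Big),$$ $$w_i^{k+1}=\frac{1}{2v_i^{k+1}}\left[\Big(u_i^{k+1}-\frac{\Lambda_i^k}{\alpha}\Big)+\sqrt{\Big(u_i^{k+1}-\frac{\Lambda_i^k}{\alpha}\Big)^2+\frac{4\lambda_2v_i^{k+1}}{\alpha}}\right]\quad(1\le i\le n),$$ $$\Lambda^{k+1}=\Lambda^k+\alpha(v^{k+1}\circ w^{k+1}-u^{k+1}).$$ The $w$-update is the exact minimizer of $w\mapsto L_\alpha(u^{k+1},v^{k+1},w,\Lambda^k)$ over $w>0$, and for $k\ge1$ the $v$-update is the exact minimizer of $v\mapsto L_\alpha(u^{k+1},v,w^k,\Lambda^k)$. Stationarity: $(u^*,v^*,w^*,\Lambda^* )$ is a stationary point of $L_\alpha$ if, at that point, $0\in\partial_uL_\alpha$, $0\in\partial_vL_\alpha$, $\nabla_wL_\alpha=0$ and $\nabla_\Lambda L_\alpha=0$; $(u^*,v^* )$ is a stationary point of $H$ if $0\in\partial_uH(u^*,v^* )$ and $0\in\partial_vH(u^*,v^* )$. Here $\partial_u,\partial_v$ are the convex subdifferentials with respect to the single variable $u$ or $v$, the others being fixed. A limit point is the limit of a convergent subsequence.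 *)

(* Defs.v *)
From HB Require Import structures.
From mathcomp Require Import all_boot all_order all_algebra.
From mathcomp Require Import all_classical all_reals all_analysis.

Set Implicit Arguments.
Unset Strict Implicit.
Unset Printing Implicit Defensive.

Import Order.TTheory GRing.Theory Num.Theory.
Import numFieldNormedType.Exports.

Local Open Scope classical_set_scope.
Local Open Scope ring_scope.

(* The library norm `|x| on 'rV[R]_n is the sup norm; the Euclidean norm is
   [norm2] below. Both induce the topology that the library puts on 'rV[R]_n. *)
Definition dotp (R : realType) (n : nat) (x y : 'rV[R]_n) : R :=
  \sum_(i < n) x 0 i * y 0 i.

Definition norm2 (R : realType) (n : nat) (x : 'rV[R]_n) : R :=
  Num.sqrt (dotp x x).

Definition hmul (R : realType) (n : nat) (x y : 'rV[R]_n) : 'rV[R]_n :=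
  map2_mx *%R x y.

(* [D] is the discrete gradient: row i of [D u] is its value at pixel i. It is
   an arbitrary linear operator with values in R^2 at each pixel, so that any
   finite-difference scheme and any boundary convention is an instance. *)
Definition TV (R : realType) (n : nat) (D : {linear 'rV[R]_n -> 'M[R]_(n, 2)})
    (u : 'rV[R]_n) : R :=
  \sum_(i < n) norm2 (row i (D u)).

Definition chiV (R : realType) (n : nat) (eps : R) (v : 'rV[R]_n) : \bar R :=
  if [forall i, eps <= v 0 i] then 0%E else +oo%E.

(* The functional is only considered for positive u and v; following the usual
   convention of convex analysis, it is +oo elsewhere. *)
Definition TVIC (R : realType) (n : nat) (D : {linear 'rV[R]_n -> 'M[R]_(n, 2)})
    (lam1 lam2 eps : R) (f u v : 'rV[R]_n) : \bar R :=
  if [forall i, (0 < u 0 i) && (0 < v 0 i)] then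
    ((lam1 / 2 * (\sum_(i < n) (f 0 i - v 0 i) ^+ 2)
      + lam2 * (\sum_(i < n) (u 0 i - v 0 i * ln (u 0 i / v 0 i) - v 0 i))
      + TV D u)%:E + chiV eps v)%E
  else +oo%E.

(* Meaningful for positive w only ([ln] is 0 on nonpositive numbers). *)
Definition augLag (R : realType) (n : nat)
    (D : {linear 'rV[R]_n -> 'M[R]_(n, 2)})
    (lam1 lam2 alpha eps : R) (f u v w Lam : 'rV[R]_n) : \bar R :=
  ((lam1 / 2 * (\sum_(i < n) (f 0 i - v 0 i) ^+ 2)
    + TV D u
    + lam2 * (\sum_(i < n) (u 0 i - v 0 i * ln (w 0 i) - v 0 i))
    + dotp Lam (hmul v w - u)
    + alpha / 2 * norm2 (hmul v w - u) ^+ 2)%:E + chiV eps v)%E.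

Definition argmin (R : realType) (T : Type) (F : T -> R) : set T :=
  [set x | forall y, F x <= F y].

(* The u-update minimizes the quadratic form of the u-subproblem. When v k lies
   in the constraint set, it differs from the augmented Lagrangian by a constant
   in u; for k = 0 the datum f = v 0 need not lie in that set, and only the
   quadratic form is then meaningful. *)
Record BCA (R : realType) (n : nat) (D : {linear 'rV[R]_n -> 'M[R]_(n, 2)})
    (lam1 lam2 alpha eps : R) (f : 'rV[R]_n)
    (u v w Lam : nat -> 'rV[R]_n) : Prop := {
  BCA_u0 : u 0%N = f ;
  BCA_v0 : v 0%N = f ;
  BCA_w0 : w 0%N = const_mx 1 ;
  BCA_Lam0 : Lam 0%N = 0 ;
  BCA_u : forall k, argmin (fun x : 'rV[R]_n =>
      alpha / 2 * norm2 (hmul (v k) (w k) + alpha^-1 *: Lam k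
                         - const_mx (lam2 / alpha) - x) ^+ 2 + TV D x)
    (u k.+1) ;
  BCA_v : forall k i, v k.+1 0 i =
    Num.max eps
      ((lam1 * f 0 i + lam2 * ln (w k 0 i) + alpha * (w k 0 i * u k.+1 0 i))
       / (lam1 + alpha * w k 0 i ^+ 2)) ;
  BCA_w : forall k i, w k.+1 0 i =
    (2 * v k.+1 0 i)^-1 *
      ((u k.+1 0 i - Lam k 0 i / alpha)
       + Num.sqrt ((u k.+1 0 i - Lam k 0 i / alpha) ^+ 2
                   + 4 * lam2 * v k.+1 0 i / alpha)) ;
  BCA_Lam : forall k,
    Lam k.+1 = Lam k + alpha *: (hmul (v k.+1) (w k.+1) - u k.+1)
}.

Definition subdiff (R : realType) (n : nat) (F : 'rV[R]_n -> \bar R)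
    (x : 'rV[R]_n) : set 'rV[R]_n :=
  [set p | F x \is a fin_num /\
           forall y : 'rV[R]_n, (F x + (dotp p (y - x))%:E <= F y)%E].

Definition grad (R : realType) (n : nat) (F : 'rV[R]_n -> R) (x : 'rV[R]_n) :
    'rV[R]_n :=
  \row_(i < n) 'D_(delta_mx 0 i) (F : 'rV[R]_n -> R^o) x.

(* The augmented Lagrangian is differentiated in w and Lam as a real function,
   through [fine]: at a point where the first two conditions hold it is finite
   for all values of w and Lam, since its only infinite term depends on v. *)
Definition stationary_augLag (R : realType) (n : nat)
    (D : {linear 'rV[R]_n -> 'M[R]_(n, 2)}) (lam1 lam2 alpha eps : R)
    (f u v w Lam : 'rV[R]_n) : Prop :=
  let L := augLag D lam1 lam2 alpha eps f in
  let Lw := (fun w' => fine (L u v w' Lam)) : 'rV[R]_n -> R^o in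
  let LLam := (fun Lam' => fine (L u v w Lam')) : 'rV[R]_n -> R^o in
  (forall i, 0 < w 0 i) /\
  [/\ subdiff (fun u' => L u' v w Lam) u 0,
      subdiff (fun v' => L u v' w Lam) v 0,
      differentiable Lw w /\ grad Lw w = 0 &
      differentiable LLam Lam /\ grad LLam Lam = 0].

Definition stationary_TVIC (R : realType) (n : nat)
    (D : {linear 'rV[R]_n -> 'M[R]_(n, 2)}) (lam1 lam2 eps : R)
    (f u v : 'rV[R]_n) : Prop :=
  let H := TVIC D lam1 lam2 eps f in
  subdiff (fun u' => H u' v) u 0 /\ subdiff (fun v' => H u v') v 0.

Definition subseq_limit (R : realType) (n : nat) (u v w Lam : nat -> 'rV[R]_n)
    (us vs ws Lams : 'rV[R]_n) : Prop :=
  exists2 phi : nat -> nat, increasing_seq phi &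
    [/\ u (phi j) @[j --> \oo] --> us, v (phi j) @[j --> \oo] --> vs,
        w (phi j) @[j --> \oo] --> ws & Lam (phi j) @[j --> \oo] --> Lams].

(* Main.v *)
Require Import Defs.
From HB Require Import structures.
From mathcomp Require Import all_boot all_order all_algebra.
From mathcomp Require Import all_classical all_reals all_analysis.
From mathcomp Require Import ring lra.

Import Order.TTheory GRing.Theory Num.Theory.
Import numFieldNormedType.Exports.

Local Open Scope classical_set_scope.
Local Open Scope ring_scope.

Set Implicit Arguments.
Unset Strict Implicit.
Unset Printing Implicit Defensive.

(** Every iterate from the first one on satisfies the exact optimality condition
    of the last w-step, which reads Lam_i w_i = lam2 ([BCA_Lam_w]). Hence the
    multiplier is a function of w, Lipschitz with constant lam2 / c^2 because
    w >= c, and this is what keeps the ascent of the multiplier step under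
    control.

    The augmented Lagrangian, which apart from the total variation is a sum
    of functions of one pixel ([augLag_coord]), is a Lyapunov function. The three
    block minimizations decrease it by the strong convexity of each subproblem,
    with moduli alpha, lam1 and alpha eps^2; the multiplier step increases it by
    |Lam^(k+1) - Lam^k|^2 / alpha, at most lam2^2 / (alpha c^4) times the square
    of the w-increment. The condition alpha > sqrt 2 lam2 / (c^2 eps) says that
    half of alpha eps^2 wins ([w_decrease_gt0]), so the Lagrangian decreases by a
    positive definite quadratic form of the increments ([energy_descent]).

    On the iterates the relation Lam_i w_i = lam2 turns the pixel terms into
      lam1/2 (f - v)^2 + lam2 v (w - ln w - 1) + lam2 (1/w - 1) d + alpha/2 d^2,
    d = v w - u, which is bounded below and coercive in v and w
    ([augLag_coord_coercive]). So the energy converges, all increments tend to 0,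
    and v and w stay bounded; Lam = lam2 / w is bounded, and u is bounded because
    d is an increment of Lam divided by alpha.

    For the limit points, each update is characterized by a condition that passes
    to the limit: a subgradient inequality for u ([argmin_TV_subgradient]), a
    variational inequality for the projection defining v, and equations for w and
    Lam. As the increments vanish, consecutive iterates share their limits, and a
    limit point solves a closed system of conditions ([optimality_system]) in which
    alpha no longer appears. That system implies stationarity both for
    the augmented Lagrangian and for the functional. *)

(** * The augmented Lagrangian at one pixel *)

Definition augLag_coord (R : realType) (lam1 lam2 alpha f u v w Lam : R) : R :=
  lam1 / 2 * (f - v) ^+ 2 + lam2 * (u - v * ln w - v)
  + Lam * (v * w - u) + alpha / 2 * (v * w - u) ^+ 2.

Lemma ln_le_tangent (R : realType) (x y : R) :
  0 < x -> 0 < y -> ln y <= ln x + (y - x) / x.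
Proof.
move=> x0 y0; rewrite -lerBlDl -ln_div ?posrE//.
have -> : y / x = 1 + (y - x) / x by field; rewrite gt_eqF.
apply: le_ln1Dx; rewrite ltr_pdivlMr//; lra.
Qed.

Section OneCoordinate.
Variables (R : realType) (lam1 lam2 alpha : R).
Hypothesis alpha_gt0 : 0 < alpha.
Implicit Types eps c f u v w Lam : R.
Local Notation ell := (augLag_coord lam1 lam2 alpha).

(** Exact second-order expansions of the quadratics in u and in v. The slope in v
    is arranged so that its last term vanishes when Lam w = lam2. *)
Lemma augLag_coord_u f u u' v w Lam :
  ell f u v w Lam = ell f u' v w Lam
    - alpha * (v * w + Lam / alpha - lam2 / alpha - u') * (u - u')
    + alpha / 2 * (u - u') ^+ 2.
Proof. by rewrite /augLag_coord; field; rewrite gt_eqF. Qed.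

Lemma augLag_coord_v f u v v' w Lam :
  ell f u v w Lam = ell f u v' w Lam
    + ((lam1 + alpha * w ^+ 2) * v'
       - (lam1 * f + lam2 * ln w + alpha * (w * u)) + (Lam * w - lam2)) * (v - v')
    + (lam1 + alpha * w ^+ 2) / 2 * (v - v') ^+ 2.
Proof. by rewrite /augLag_coord; field. Qed.

(** The logarithmic term only contributes convexity, so the quadratic term alone
    gives the decrease at the minimizer w'. The optimality condition is written as
    the statement that the updated multiplier times w' is lam2. *)
Lemma augLag_coord_w f u v w w' Lam : 0 <= lam2 -> 0 <= v -> 0 < w -> 0 < w' ->
  (Lam + alpha * (v * w' - u)) * w' = lam2 ->
  ell f u v w' Lam + alpha / 2 * v ^+ 2 * (w - w') ^+ 2 <= ell f u v w Lam.
Proof.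
move=> l0 v0 w0 w'0 opt.
have tan : lam2 * v * (ln w - ln w') <= v * (Lam + alpha * (v * w' - u)) * (w - w').
  rewrite -opt; set m := _ + _.
  have -> : v * m * (w - w') = m * w' * v * ((w - w') / w').
    by field; rewrite gt_eqF.
  rewrite opt; apply: ler_wpM2l; first exact: mulr_ge0.
  by rewrite lerBlDl ln_le_tangent.
suff -> : ell f u v w Lam = ell f u v w' Lam + alpha / 2 * v ^+ 2 * (w - w') ^+ 2
  + (v * (Lam + alpha * (v * w' - u)) * (w - w') - lam2 * v * (ln w - ln w')).
  by lra.
by rewrite /augLag_coord; field.
Qed.

Lemma augLag_coord_Lam f u v w Lam Lam' :
  ell f u v w Lam' = ell f u v w Lam + (Lam' - Lam) * (v * w - u).
Proof. by rewrite /augLag_coord; ring. Qed.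

(** With Lam = lam2 / w and d = v w - u, the part without the data term is
      lam2 v (w - ln w - 1) + lam2 (1/w - 1) d + alpha/2 d^2.
    Its first summand grows linearly in w since ln w <= w / 2; completing the
    square in d bounds the rest below, as |1/w - 1| <= 1/c + 1. *)
Lemma augLag_coord_coercive eps c f u v w Lam :
  0 < lam2 -> 0 < eps -> 0 < c -> eps <= v -> c <= w -> Lam * w = lam2 ->
  lam1 / 2 * (f - v) ^+ 2 + lam2 * eps / 2 * w <= ell f u v w Lam
    + (lam2 * eps + lam2 ^+ 2 * (c^-1 + 1) ^+ 2 / (2 * alpha)).
Proof.
move=> l0 e0 c0 ev cw Lw; have w0 : 0 < w by exact: lt_le_trans cw.
pose d : R := v * w - u; pose r : R := w^-1 - 1; pose K : R := c^-1 + 1.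
have -> : ell f u v w Lam = lam1 / 2 * (f - v) ^+ 2
    + lam2 * v * (w - ln w - 1) + (lam2 * r * d + alpha / 2 * d ^+ 2).
  rewrite /augLag_coord /d /r.
  have -> : Lam = lam2 / w by rewrite -Lw mulfK// gt_eqF.
  by field; rewrite gt_eqF.
(* the tangent of ln at 2, together with ln 2 <= 1 *)
have lnw : ln w <= w / 2.
  have := @ln_le_tangent R 2 w ltac:(lra) w0.
  have := @ln_le_tangent R 1 2 ltac:(lra) ltac:(lra); rewrite ln1; lra.
have lnw1 : 0 <= w - ln w - 1.
  have := @ln_le_tangent R 1 w ltac:(lra) w0; rewrite ln1; lra.
have vb : lam2 * eps * (w / 2 - 1) <= lam2 * v * (w - ln w - 1).
  apply: (@le_trans _ _ (lam2 * eps * (w - ln w - 1))).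
    by apply: ler_wpM2l; [rewrite mulr_ge0// ltW|lra].
  by apply: ler_wpM2r => //; rewrite ler_pM2l.
have sqr_mono (x y : R) : 0 < x -> x <= y -> (x - 1) ^+ 2 <= (y + 1) ^+ 2.
  by move=> x0 xy; rewrite -subr_ge0 subr_sqr mulr_ge0//; lra.
have rK : r ^+ 2 <= K ^+ 2.
  by apply: sqr_mono; rewrite ?invr_gt0// lef_pV2 ?posrE.
have sq : lam2 * r * d + alpha / 2 * d ^+ 2 + lam2 ^+ 2 * r ^+ 2 / (2 * alpha)
    = (alpha * d + lam2 * r) ^+ 2 / (2 * alpha) by field; rewrite gt_eqF.
have : 0 <= (alpha * d + lam2 * r) ^+ 2 / (2 * alpha).
  by apply: divr_ge0; [exact: sqr_ge0|rewrite mulr_ge0// ltW].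
rewrite -sq.
have : lam2 ^+ 2 * r ^+ 2 / (2 * alpha) <= lam2 ^+ 2 * K ^+ 2 / (2 * alpha).
  rewrite ler_pM2r ?invr_gt0 ?mulr_gt0//.
  by rewrite ler_wpM2l ?sqr_ge0.
rewrite -/K; move: (lam2 ^+ 2 * r ^+ 2 / _) (lam2 ^+ 2 * K ^+ 2 / _) => A B; lra.
Qed.

End OneCoordinate.

(** * Sequences, subsequences and separable functions *)

Lemma cvgn_unique (R : realType) (x y : nat -> R) (a b : R) :
  x =1 y -> x @ \oo --> a -> y @ \oo --> b -> a = b.
Proof. by move=> /funext -> xa xb; exact: (cvg_unique (@Rhausdorff R) xa xb). Qed.

Lemma cvg_rVP (R : realType) n (x : nat -> 'rV[R]_n) (l : 'rV[R]_n) :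
  (x @ \oo --> l) <-> (forall i, x k 0 i @[k --> \oo] --> l 0 i).
Proof.
split=> [xl i|xl].
  exact: (continuous_cvg _ (@coord_continuous R 1 n 0 i l) xl).
apply/cvg_ballP => e e0.
have : \forall k \near \oo, forall i, ball (l 0 i) e (x k 0 i).
  by apply: filter_forall => i; move/cvg_ballP : (xl i); apply.
apply: filterS => k xk; split => // i j; rewrite ord1; exact: xk.
Qed.

Lemma increasing_seq_cvgoo (phi : nat -> nat) :
  increasing_seq phi -> phi @ \oo --> \oo.
Proof.
move=> /increasing_seqP phiS A [N _ NA]; exists N => // k /= Nk; apply: NA => /=.
apply: leq_trans Nk _; elim: k => // k ih; exact: leq_ltn_trans (phiS k).
Qed.

Lemma increasing_seq_comp (phi psi : nat -> nat) :
  increasing_seq phi -> increasing_seq psi -> increasing_seq (phi \o psi).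
Proof. by move=> iphi ipsi m n /=; rewrite iphi -leEnat ipsi. Qed.

(** Extracting successively along the list of indices keeps the limits already
    obtained, since a subsequence of a convergent sequence converges. *)
Lemma bolzano_weierstrass_finite (R : realType) (I : finType) (x : I -> nat -> R)
    (M : R) : (forall i k, `|x i k| <= M) ->
  exists2 phi, increasing_seq phi & forall i, cvgn (x i \o phi).
Proof.
move=> xM.
suff : forall s : seq I, exists2 phi, increasing_seq phi &
    forall i, i \in s -> cvgn (x i \o phi).
  move=> /(_ (enum I)) [phi iphi c]; exists phi => // i; apply: c.
  by rewrite mem_enum.
elim=> [|j s [phi iphi c]]; first by exists id.
have [psi ipsi cj] : exists2 psi, increasing_seq psi &
    cvgn ((x j \o phi) \o psi).
  apply: bolzano_weierstrass; exists M; split; first exact: num_real.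
  by move=> y My k _ /=; apply: le_trans (ltW My).
exists (phi \o psi) => [|i]; first exact: increasing_seq_comp.
rewrite inE => /orP[/eqP -> //|/c]; move=> /cvg_ex[l xl].
apply/cvg_ex; exists l.
exact: (cvg_comp _ _ (increasing_seq_cvgoo ipsi) xl).
Qed.

(** E is nonincreasing and bounded below, hence convergent, so that its
    decrements tend to 0, and they dominate a x_k^2. *)
Lemma cvg0_of_descent (R : realType) (E : nat -> R) (B a : R) (x : nat -> R) :
  (forall k, B <= E k) -> 0 < a ->
  (forall k, E k.+1 + a * x k ^+ 2 <= E k) ->
  x @ \oo --> 0.
Proof.
move=> BE a0 dE.
have Ecvg : cvgn E.
  apply: nonincreasing_is_cvgn; last by exists B => _ [k _ <-].
  apply/nonincreasing_seqP => k; apply: le_trans (dE k).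
  by rewrite lerDl mulr_ge0 ?sqr_ge0// ltW.
have dE0 : E k - E k.+1 @[k --> \oo] --> 0.
  rewrite -(subrr (limn E)); apply: cvgB => //.
  by rewrite (cvg_shiftS E).
apply/cvgr0Pnorm_le => e e0.
have ae : 0 < a * e ^+ 2 by rewrite mulr_gt0 ?exprn_gt0.
move/cvgr0Pnorm_le : dE0 => /(_ _ ae); apply: filterS => k.
move=> /(le_trans (ler_norm _)) dEk.
have : a * x k ^+ 2 <= a * e ^+ 2 by have := dE k; lra.
by rewrite ler_pM2l// -real_normK ?num_real// ler_sqr ?nnegrE// ltW.
Qed.

Lemma is_derive_coord (R : realType) n (g : R -> R) (dg : R) (x v : 'rV[R]_n) i :
  is_derive (x 0 i) 1 g dg ->
  let G := fun y : 'rV[R]_n => g (y 0 i) in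
  differentiable G x /\ is_derive x v G (v 0 i * dg).
Proof.
move=> [gd <-] G.
pose f (y : 'rV[R]_n) : R := y 0 i.
have dc : differentiable f x by exact: differentiable_coord.
have dgx : differentiable g (f x) by apply/derivable1_diffP.
have dG : differentiable G x by exact: (differentiable_comp dc dgx).
split=> [|{dG}]; first exact: dG.
have GE : G = g \o f by [].
have := @diff_derivable _ _ _ _ _ v (differentiable_comp dc dgx).
rewrite -GE => Gd; apply: (DeriveDef Gd).
rewrite GE deriveE; last exact: (differentiable_comp dc dgx).
rewrite (diff_comp dc dgx) /= (deriv1E gd) derive1E.
congr (_ *: _).
have lf : linear f by move=> a y z; rewrite /f !mxE.
pose LM := GRing.isLinear.Build _ _ _ _ f lf.
pose F : {linear 'rV[R]_n -> R} := HB.pack f LM.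
rewrite -[f]/(F : _ -> _) diff_lin//; exact: coord_continuous.
Qed.

(** The augmented Lagrangian is of this form as a function of w and as a function
    of Lam, which reduces its gradients to derivatives in one variable. *)
Lemma separable_grad (R : realType) n (C : R) (g : 'I_n -> R -> R)
    (dg : 'I_n -> R) (x : 'rV[R]_n) :
  (forall i, is_derive (x 0 i) 1 (g i) (dg i)) ->
  let F := (fun y => C + \sum_(i < n) g i (y 0 i)) : 'rV[R]_n -> R^o in
  differentiable F x /\ grad F x = \row_i dg i.
Proof.
move=> gdg F.
have FE : F = cst C + \sum_(i < n) (fun y : 'rV[R]_n => g i (y 0 i) : R^o).
  apply/funext => y; rewrite /F fctE; congr (_ + _).
  by rewrite fct_sumE.
split.
  rewrite FE; apply: differentiableD; first exact: differentiable_cst.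
  by apply: differentiable_sum => i; have [] := is_derive_coord 0 (gdg i).
apply/rowP => j; rewrite !mxE -/F FE.
have [_ ->] : is_derive x (delta_mx 0 j) (cst C + \sum_(i < n)
   (fun y : 'rV[R]_n => g i (y 0 i) : R^o))
   (0 + \sum_(i < n) (delta_mx 0 j : 'rV[R]_n) 0 i * dg i).
  apply: is_deriveD; apply: is_derive_sum => i.
  by have [] := is_derive_coord (delta_mx 0 j) (gdg i).
rewrite add0r (bigD1 j)//= mxE !eqxx mul1r big1 ?addr0// => i ij.
by rewrite mxE (negbTE ij) andbF mul0r.
Qed.

(** * Euclidean norm and total variation *)

Lemma dotpN (R : realType) n (x : 'rV[R]_n) : dotp x x = \sum_i x 0 i ^+ 2.
Proof. by apply: eq_bigr => i _; rewrite expr2. Qed.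

Lemma dotp0l (R : realType) n (y : 'rV[R]_n) : dotp 0 y = 0.
Proof. by rewrite /dotp big1// => i _; rewrite mxE mul0r. Qed.

Lemma norm2_sqr (R : realType) n (x : 'rV[R]_n) : norm2 x ^+ 2 = dotp x x.
Proof. by rewrite sqr_sqrtr// dotpN sumr_ge0// => i _; exact: sqr_ge0. Qed.

Lemma norm2_ge0 (R : realType) n (x : 'rV[R]_n) : 0 <= norm2 x.
Proof. exact: sqrtr_ge0. Qed.

(** Cauchy-Schwarz: expand the sum of the squares of s x_i - t y_i and choose
    s and t to be the norm of y and of x. *)
Lemma dotp_le_norm2 (R : realType) n (x y : 'rV[R]_n) :
  dotp x y <= norm2 x * norm2 y.
Proof.
set a := norm2 x; set b := norm2 y.
have a0 : 0 <= a by exact: norm2_ge0.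
have b0 : 0 <= b by exact: norm2_ge0.
have expand (s t : R) : \sum_i (s * x 0 i - t * y 0 i) ^+ 2
    = s ^+ 2 * a ^+ 2 + t ^+ 2 * b ^+ 2 - 2 * s * t * dotp x y.
  rewrite !norm2_sqr !dotpN /dotp !mulr_sumr -big_split/= -sumrB.
  by apply: eq_bigr => i _; ring.
have pos (s t : R) : 0 <= s ^+ 2 * a ^+ 2 + t ^+ 2 * b ^+ 2 - 2 * s * t * dotp x y.
  by rewrite -expand sumr_ge0// => i _; exact: sqr_ge0.
have [ab0|ab0] := ltP 0 (a * b).
  have := pos b a; nra.
have {}ab0 : a * b = 0 by apply/eqP; rewrite eq_le ab0 mulr_ge0.
rewrite ab0; move/eqP : ab0; rewrite mulf_eq0.
(* if a = 0 the form is linear in s, so that the choice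
   t = dotp x y, s = b ^+ 2 + 1 forces - (b ^+ 2 + 2) * dotp x y ^+ 2 to be
   nonnegative; the case b = 0 is symmetric *)
move=> /orP[] /eqP z.
  by have := pos (b ^+ 2 + 1) (dotp x y); rewrite z; nra.
by have := pos (dotp x y) (a ^+ 2 + 1); rewrite z; nra.
Qed.

Lemma norm2D (R : realType) n (x y : 'rV[R]_n) :
  norm2 (x + y) <= norm2 x + norm2 y.
Proof.
rewrite -(@ler_pXn2r _ 2)// ?nnegrE ?addr_ge0 ?norm2_ge0//.
rewrite sqrrD !norm2_sqr.
have -> : dotp (x + y) (x + y)
    = dotp x x + dotp x y *+ 2 + dotp y y.
  rewrite /dotp -sumrMnl -!big_split/=.
  by apply: eq_bigr => i _; rewrite mxE; ring.
by rewrite lerD2r lerD2l lerMn2r/= dotp_le_norm2.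
Qed.

Lemma norm2Z (R : realType) n (t : R) (x : 'rV[R]_n) :
  0 <= t -> norm2 (t *: x) = t * norm2 x.
Proof.
move=> t0; rewrite /norm2.
have -> : dotp (t *: x) (t *: x) = t ^+ 2 * dotp x x.
  by rewrite /dotp mulr_sumr; apply: eq_bigr => i _; rewrite !mxE; ring.
by rewrite sqrtrM ?sqr_ge0// sqrtr_sqr ger0_norm.
Qed.

Lemma norm2_le_sum (R : realType) n (x : 'rV[R]_n) :
  norm2 x <= \sum_i `|x 0 i|.
Proof.
have S0 : 0 <= \sum_i `|x 0 i| by apply: sumr_ge0.
rewrite -(@ler_pXn2r _ 2)// ?nnegrE ?norm2_ge0// norm2_sqr dotpN.
rewrite expr2 mulr_suml; apply: ler_sum => i _.
rewrite -real_normK ?num_real// expr2 ler_wpM2l//.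
by rewrite (bigD1 i)//= lerDl sumr_ge0.
Qed.

(** The bound is only asked from index 1 on because the initial iterate has to
    be treated apart. *)
Lemma norm2_bounded (R : realType) n (x : nat -> 'rV[R]_n) (M : R) :
  (forall k i, `|x k.+1 0 i| <= M) -> exists B, forall k, norm2 (x k) <= B.
Proof.
move=> xM; exists (Num.max (norm2 (x 0%N)) (\sum_(i < n) M)) => -[|k].
  by rewrite le_max lexx.
rewrite le_max; apply/orP; right; apply: le_trans (norm2_le_sum _) _.
by apply: ler_sum => i _.
Qed.

Section TotalVariation.
Variables (R : realType) (n : nat) (D : {linear 'rV[R]_n -> 'M[R]_(n, 2)}).

Lemma TV_ge0 (x : 'rV[R]_n) : 0 <= TV D x.
Proof. by apply: sumr_ge0 => i _; exact: norm2_ge0. Qed.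

Lemma TV_convex (x y : 'rV[R]_n) (t : R) : 0 <= t <= 1 ->
  TV D (x + t *: (y - x)) <= (1 - t) * TV D x + t * TV D y.
Proof.
move=> /andP[t0 t1]; rewrite /TV !mulr_sumr -big_split/=; apply: ler_sum => i _.
have -> : row i (D (x + t *: (y - x)))
    = (1 - t) *: row i (D x) + t *: row i (D y).
  by rewrite linearD linearZ linearB/=; apply/rowP => j; rewrite !mxE; ring.
by apply: le_trans (norm2D _ _) _; rewrite !norm2Z// subr_ge0.
Qed.

Lemma TV_cvg (x : nat -> 'rV[R]_n) (l : 'rV[R]_n) :
  x @ \oo --> l -> TV D (x k) @[k --> \oo] --> TV D l.
Proof.
move=> /cvg_rVP xl.
have DE (y : 'rV[R]_n) i j : D y i j = \sum_k y 0 k * D (delta_mx 0 k) i j.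
  rewrite {1}(row_sum_delta y) linear_sum summxE.
  by apply: eq_bigr => k _; rewrite linearZ mxE.
apply: cvg_big => [|i _]; first exact: add_continuous.
apply: (continuous_cvg _ (@sqrt_continuous R _)).
apply: cvg_big => [|j _]; first exact: add_continuous.
have Dl : row i (D (x k)) 0 j @[k --> \oo] --> row i (D l) 0 j.
  rewrite mxE DE; under eq_cvg do rewrite mxE DE.
  apply: cvg_big => [|m _]; first exact: add_continuous.
  by apply: cvgM => //; exact: cvg_cst.
exact: cvgM.
Qed.

(** The gradient of the quadratic part at the minimizer is the opposite of a
    subgradient of the total variation: compare the minimizer x with
    x + t (y - x), divide by t, and let t tend to 0 along 1 / (k + 1). *)
Lemma argmin_TV_subgradient (alpha : R) (z x : 'rV[R]_n) :
  argmin (fun x => alpha / 2 * norm2 (z - x) ^+ 2 + TV D x) x ->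
  forall y : 'rV[R]_n, TV D x + alpha * (\sum_i (z 0 i - x 0 i) * (y 0 i - x 0 i))
    <= TV D y.
Proof.
move=> xmin y.
set S := \sum_i _; set Q := \sum_i (y 0 i - x 0 i) ^+ 2.
have normE (t : R) : norm2 (z - (x + t *: (y - x))) ^+ 2
   = norm2 (z - x) ^+ 2 - 2 * t * S + t ^+ 2 * Q.
  rewrite !norm2_sqr !dotpN /S /Q !mulr_sumr -sumrB -big_split/=.
  by apply: eq_bigr => i _; rewrite !mxE; ring.
have key (t : R) : 0 < t <= 1 ->
    alpha * S - t * (alpha / 2 * Q) <= TV D y - TV D x.
  move=> /andP[t0 t1]; rewrite -(ler_pM2l t0).
  have := xmin (x + t *: (y - x)); rewrite normE.
  by have := @TV_convex x y t; rewrite (ltW t0) t1 => /(_ isT); lra.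
suff : alpha * S <= TV D y - TV D x by lra.
have lim : alpha * S - k.+1%:R^-1 * (alpha / 2 * Q) @[k --> \oo] --> alpha * S.
  rewrite -[X in _ --> X]subr0 -(mul0r (alpha / 2 * Q)).
  apply: cvgB; first exact: cvg_cst.
  by apply: cvgM; [exact: cvg_harmonic|exact: cvg_cst].
apply: cvgr_to_le lim _; near=> k; apply: key.
by rewrite invr_gt0 ltr0n/= invf_le1 ?ler1n ?ltr0n.
Unshelve. all: by end_near. Qed.

End TotalVariation.

(** * From the optimality system to stationarity *)

Definition TVIC_coord (R : realType) (lam1 lam2 f u v : R) : R :=
  lam1 / 2 * (f - v) ^+ 2 + lam2 * (u - v * ln (u / v) - v).

(** The concavity of ln at u gives ln y <= ln u + (y - u) / u, and the hypothesis
    says that Lam is the derivative lam2 v / u. *)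
Lemma TVIC_coord_u (R : realType) (lam1 lam2 f u v Lam y : R) :
  0 < lam2 -> 0 < u -> 0 < v -> 0 < y -> Lam * u = lam2 * v ->
  TVIC_coord lam1 lam2 f u v - (Lam - lam2) * (y - u) <= TVIC_coord lam1 lam2 f y v.
Proof.
move=> l0 u0 v0 y0 Lamu.
have : lam2 * v * (ln y - ln u) <= Lam * (y - u).
  have -> : Lam * (y - u) = lam2 * v * ((y - u) / u).
    by rewrite -Lamu; field; rewrite gt_eqF.
  by rewrite ler_pM2l ?mulr_gt0// lerBlDl ln_le_tangent.
by rewrite /TVIC_coord !ln_div ?posrE//; lra.
Qed.

(** The subgradient inequality at v of a function which is convex in its last
    argument: the excess is lam1/2 (y - v)^2 plus lam2 times the relative entropy
    y ln (y / v) - y + v. *)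
Lemma TVIC_coord_v (R : realType) (lam1 lam2 f u v y : R) :
  0 < lam1 -> 0 < lam2 -> 0 < u -> 0 < v -> 0 < y ->
  TVIC_coord lam1 lam2 f u v + (lam1 * (v - f) - lam2 * (ln u - ln v)) * (y - v)
    <= TVIC_coord lam1 lam2 f u y.
Proof.
move=> l1 l2 u0 v0 y0.
have tan : 0 <= lam2 * (y * (ln y - ln v) - (y - v)).
  rewrite mulr_ge0 ?(ltW l2)// subr_ge0.
  have -> : y - v = y * - ((v - y) / y) by field; rewrite gt_eqF.
  by rewrite ler_pM2l//; have := ln_le_tangent y0 v0; lra.
have quad : 0 <= lam1 / 2 * (y - v) ^+ 2.
  by rewrite mulr_ge0 ?sqr_ge0// divr_ge0// ltW.
suff -> : TVIC_coord lam1 lam2 f u y = TVIC_coord lam1 lam2 f u v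
   + (lam1 * (v - f) - lam2 * (ln u - ln v)) * (y - v)
   + (lam1 / 2 * (y - v) ^+ 2 + lam2 * (y * (ln y - ln v) - (y - v))) by lra.
by rewrite /TVIC_coord !ln_div ?posrE//; field.
Qed.

Lemma is_derive_augLag_coord_w (R : realType) (lam1 lam2 alpha f u v w Lam : R) :
  0 < w ->
  is_derive w 1 (fun x => augLag_coord lam1 lam2 alpha f u v x Lam)
    (v * (Lam - lam2 / w + alpha * (v * w - u))).
Proof.
move=> w0.
pose A := lam1 / 2 * (f - v) ^+ 2 + lam2 * (u - v) - Lam * u + alpha / 2 * u ^+ 2.
have -> : (fun x => augLag_coord lam1 lam2 alpha f u v x Lam)
  = (fun x => A + - lam2 * v *: ln x + (Lam * v - alpha * v * u) *: x
              + alpha / 2 * v ^+ 2 *: (x * x)).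
  by apply/funext => x; rewrite /augLag_coord /A /GRing.scale/=; field.
have d1 := is_derive_id w (1 : R).
have d := is_deriveD (is_deriveD (is_deriveD (is_derive_cst A w 1)
  (is_deriveZ (- lam2 * v) (is_derive1_ln w0)))
  (is_deriveZ (Lam * v - alpha * v * u) d1))
  (is_deriveZ (alpha / 2 * v ^+ 2) (is_deriveM d1 d1)).
by apply: (is_derive_eq d); rewrite /GRing.scale/=; field; rewrite gt_eqF.
Qed.

Lemma is_derive_augLag_coord_Lam (R : realType) (lam1 lam2 alpha f u v w Lam : R) :
  is_derive Lam 1 (augLag_coord lam1 lam2 alpha f u v w) (v * w - u).
Proof.
have -> : augLag_coord lam1 lam2 alpha f u v w
  = (fun x => augLag_coord lam1 lam2 alpha f u v w 0 + (v * w - u) *: x).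
  by apply/funext => x; rewrite /augLag_coord /GRing.scale/=; ring.
have d := is_deriveD (is_derive_cst (augLag_coord lam1 lam2 alpha f u v w 0) Lam 1)
  (is_deriveZ (v * w - u) (is_derive_id Lam (1 : R))).
by apply: (is_derive_eq d); rewrite /GRing.scale/= add0r mulr1.
Qed.

(** The first-order conditions met by the limit points, after elimination of
    alpha by means of v w = u and Lam w = lam2. The vector Lam - lam2 is a
    subgradient of the total variation at u, and the last condition expresses that
    v minimizes its subproblem over the half-line from eps. *)
Record optimality_system (R : realType) (n : nat)
    (D : {linear 'rV[R]_n -> 'M[R]_(n, 2)}) (lam1 lam2 eps : R)
    (f u v w Lam : 'rV[R]_n) : Prop := OptimalitySystem {
  opt_w_gt0 : forall i, 0 < w 0 i ;
  opt_v_ge : forall i, eps <= v 0 i ;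
  opt_feasible : forall i, v 0 i * w 0 i = u 0 i ;
  opt_Lam : forall i, Lam 0 i * w 0 i = lam2 ;
  opt_u : forall y : 'rV[R]_n,
    TV D u + \sum_i (Lam 0 i - lam2) * (y 0 i - u 0 i) <= TV D y ;
  opt_v : forall i (y : R), eps <= y ->
    0 <= (lam1 * (v 0 i - f 0 i) - lam2 * ln (w 0 i)) * (y - v 0 i)
}.

Section Stationarity.
Variables (R : realType) (n : nat) (D : {linear 'rV[R]_n -> 'M[R]_(n, 2)}).
Variables (lam1 lam2 alpha eps : R).
Implicit Types f u v w Lam : 'rV[R]_n.

Lemma augLagE f u v w Lam :
  augLag D lam1 lam2 alpha eps f u v w Lam =
  ((\sum_i augLag_coord lam1 lam2 alpha (f 0 i) (u 0 i) (v 0 i) (w 0 i) (Lam 0 i)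
    + TV D u)%:E + chiV eps v)%E.
Proof.
congr (_%:E + _)%E; rewrite norm2_sqr dotpN /dotp !mulr_sumr.
have -> : \sum_i augLag_coord lam1 lam2 alpha (f 0 i) (u 0 i) (v 0 i) (w 0 i) (Lam 0 i)
    = \sum_i lam1 / 2 * (f 0 i - v 0 i) ^+ 2
    + \sum_i lam2 * (u 0 i - v 0 i * ln (w 0 i) - v 0 i)
    + \sum_i Lam 0 i * (hmul v w - u) 0 i
    + \sum_i alpha / 2 * (hmul v w - u) 0 i ^+ 2.
  by rewrite -!big_split/=; apply: eq_bigr => i _; rewrite !mxE.
by rewrite -!addrA; congr (_ + _); rewrite addrC -!addrA.
Qed.

Lemma chiV_in v : (forall i, eps <= v 0 i) -> chiV eps v = 0%E.
Proof. by move=> ev; rewrite /chiV; case: ifPn => // /forallP[]. Qed.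

Lemma chiV_notin v : ~ (forall i, eps <= v 0 i) -> chiV eps v = +oo%E.
Proof. by move=> ev; rewrite /chiV; case: ifPn => // /forallP. Qed.

Hypotheses (lam1_gt0 : 0 < lam1) (lam2_gt0 : 0 < lam2).
Hypotheses (alpha_gt0 : 0 < alpha) (eps_gt0 : 0 < eps).
Variables (f u v w Lam : 'rV[R]_n).
Hypothesis opt : optimality_system D lam1 lam2 eps f u v w Lam.

Let w_gt0 := opt_w_gt0 opt.
Let v_ge := opt_v_ge opt.
Let vwu := opt_feasible opt.
Let Lamw := opt_Lam opt.
Let optu := opt_u opt.
Let optv := opt_v opt.
Let v_gt0 i : 0 < v 0 i. Proof. exact: lt_le_trans (v_ge i). Qed.

(** Adding the subgradient inequality of the total variation to the exact
    expansion of the quadratic in u leaves only a square. The same scheme, with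
    the variational inequality for v, gives the next lemma. *)
Lemma augLag_subdiff_u :
  subdiff (fun u' => augLag D lam1 lam2 alpha eps f u' v w Lam) u 0.
Proof.
split=> [|y]; first by rewrite augLagE chiV_in// adde0.
rewrite !augLagE chiV_in// dotp0l !adde0 lee_fin.
apply: le_trans (_ : _ <= \sum_i (augLag_coord lam1 lam2 alpha (f 0 i) (u 0 i)
   (v 0 i) (w 0 i) (Lam 0 i) - (Lam 0 i - lam2) * (y 0 i - u 0 i)) + TV D y) _.
  by rewrite sumrB; have := optu y; lra.
rewrite lerD2r; apply: ler_sum => i _.
rewrite (augLag_coord_u _ _ alpha_gt0 _ (y 0 i) (u 0 i)) vwu.
have : 0 <= alpha / 2 * (y 0 i - u 0 i) ^+ 2.
  by rewrite mulr_ge0 ?sqr_ge0// ltW// divr_gt0.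
suff -> : alpha * (u 0 i + Lam 0 i / alpha - lam2 / alpha - u 0 i)
  = Lam 0 i - lam2 by lra.
by field; rewrite gt_eqF.
Qed.

Lemma augLag_subdiff_v :
  subdiff (fun v' => augLag D lam1 lam2 alpha eps f u v' w Lam) v 0.
Proof.
split=> [|y]; first by rewrite augLagE chiV_in// adde0.
rewrite !augLagE [in X in (X <= _)%E]chiV_in// dotp0l !adde0.
have [ey|ney] := pselect (forall i, eps <= y 0 i); last first.
  by rewrite (chiV_notin ney) addey// leey.
rewrite chiV_in// adde0 lee_fin lerD2r; apply: ler_sum => i _.
rewrite (augLag_coord_v _ _ _ _ _ (y 0 i) (v 0 i)) Lamw.
have : 0 <= (lam1 + alpha * w 0 i ^+ 2) / 2 * (y 0 i - v 0 i) ^+ 2.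
  rewrite mulr_ge0 ?sqr_ge0// divr_ge0// addr_ge0 ?mulr_ge0 ?sqr_ge0//; exact: ltW.
have := optv i (ey i); rewrite -vwu; lra.
Qed.

(** As functions of w, or of Lam, the Lagrangian is a constant plus a sum of
    functions of the coordinates, whose derivatives vanish by v w = u and
    Lam w = lam2. *)
Lemma augLag_stationary : stationary_augLag D lam1 lam2 alpha eps f u v w Lam.
Proof.
have LE w' Lam' : fine (augLag D lam1 lam2 alpha eps f u v w' Lam')
  = TV D u + \sum_i augLag_coord lam1 lam2 alpha
      (f 0 i) (u 0 i) (v 0 i) (w' 0 i) (Lam' 0 i).
  by rewrite augLagE chiV_in// adde0 addrC.
split; first exact: w_gt0.
split; [exact: augLag_subdiff_u|exact: augLag_subdiff_v| |].
- pose g i (x : R) := augLag_coord lam1 lam2 alpha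
      (f 0 i) (u 0 i) (v 0 i) x (Lam 0 i).
  have gd i : is_derive (w 0 i) 1 (g i) 0.
    apply: is_derive_eq (is_derive_augLag_coord_w _ _ _ _ _ _ _ (w_gt0 i)) _.
    by rewrite vwu subrr mulr0 addr0 -(Lamw i) mulfK ?gt_eqF// subrr mulr0.
  have [dF gF] := separable_grad (TV D u) gd.
  rewrite (_ : (fun w' => _) = fun y => TV D u + \sum_i g i (y 0 i)); last first.
    by apply/funext => w'; rewrite LE.
  by split=> //; rewrite gF; apply/rowP => i; rewrite !mxE.
- pose g i (x : R) := augLag_coord lam1 lam2 alpha
      (f 0 i) (u 0 i) (v 0 i) (w 0 i) x.
  have gd i : is_derive (Lam 0 i) 1 (g i) 0.
    apply: is_derive_eq (is_derive_augLag_coord_Lam _ _ _ _ _ _ _ _) _.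
    by rewrite vwu subrr.
  have [dF gF] := separable_grad (TV D u) gd.
  rewrite (_ : (fun Lam' => _) = fun y => TV D u + \sum_i g i (y 0 i)); last first.
    by apply/funext => Lam'; rewrite LE.
  by split=> //; rewrite gF; apply/rowP => i; rewrite !mxE.
Qed.

Let u_gt0 i : 0 < u 0 i. Proof. by rewrite -vwu mulr_gt0. Qed.

Lemma TVICE u' v' : (forall i, 0 < u' 0 i) -> (forall i, 0 < v' 0 i) ->
  TVIC D lam1 lam2 eps f u' v' =
  ((\sum_i TVIC_coord lam1 lam2 (f 0 i) (u' 0 i) (v' 0 i) + TV D u')%:E
   + chiV eps v')%E.
Proof.
move=> u0 v0; rewrite /TVIC ifT; last by apply/forallP => i; rewrite u0 v0.
by rewrite !mulr_sumr -big_split.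
Qed.

Lemma TVIC_notin u' v' : ~ (forall i, 0 < u' 0 i /\ 0 < v' 0 i) ->
  TVIC D lam1 lam2 eps f u' v' = +oo%E.
Proof.
move=> uv; rewrite /TVIC; case: ifPn => // /forallP uv0; exfalso; apply: uv => i.
exact/andP.
Qed.

(** The convex function of u in the functional has the slope lam2 - lam2 v / u,
    which is lam2 - Lam because u = v w. *)
Lemma TVIC_subdiff_u : subdiff (fun u' => TVIC D lam1 lam2 eps f u' v) u 0.
Proof.
split=> [|y]; first by rewrite TVICE// chiV_in// adde0.
rewrite TVICE// chiV_in// dotp0l !adde0.
have [y0|ny0] := pselect (forall i, 0 < y 0 i); last first.
  by rewrite TVIC_notin ?leey// => yv; apply: ny0 => i; case: (yv i).
rewrite TVICE// chiV_in// adde0 lee_fin.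
apply: le_trans (_ : _ <= \sum_i (TVIC_coord lam1 lam2 (f 0 i) (u 0 i) (v 0 i)
    - (Lam 0 i - lam2) * (y 0 i - u 0 i)) + TV D y) _.
  by rewrite sumrB; have := optu y; lra.
rewrite lerD2r; apply: ler_sum => i _.
by apply: TVIC_coord_u => //; rewrite -vwu mulrCA Lamw mulrC.
Qed.

Lemma TVIC_subdiff_v : subdiff (fun v' => TVIC D lam1 lam2 eps f u v') v 0.
Proof.
split=> [|y]; first by rewrite TVICE// chiV_in// adde0.
rewrite TVICE// chiV_in// dotp0l !adde0.
have [y0|ny0] := pselect (forall i, 0 < y 0 i); last first.
  by rewrite TVIC_notin ?leey// => yv; apply: ny0 => i; case: (yv i).
rewrite TVICE//.
have [ey|ney] := pselect (forall i, eps <= y 0 i); last first.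
  by rewrite (chiV_notin ney) addey// leey.
rewrite chiV_in// adde0 lee_fin lerD2r; apply: ler_sum => i _.
apply: le_trans (TVIC_coord_v _ lam1_gt0 lam2_gt0 (u_gt0 i) (v_gt0 i) (y0 i)).
have lnw : ln (w 0 i) = ln (u 0 i) - ln (v 0 i).
  by rewrite -vwu lnM ?posrE// addrAC subrr add0r.
by rewrite lerDl -lnw optv.
Qed.

Lemma TVIC_stationary : stationary_TVIC D lam1 lam2 eps f u v.
Proof. by split; [exact: TVIC_subdiff_u|exact: TVIC_subdiff_v]. Qed.

End Stationarity.

(** * The iterates of block coordinate descent *)

Section BlockCoordinateDescent.
Variables (R : realType) (n : nat) (D : {linear 'rV[R]_n -> 'M[R]_(n, 2)}).
Variables (lam1 lam2 alpha eps : R) (f : 'rV[R]_n).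
Variables (u v w Lam : nat -> 'rV[R]_n) (c : R).
Hypotheses (lam1_gt0 : 0 < lam1) (lam2_gt0 : 0 < lam2).
Hypotheses (alpha_gt0 : 0 < alpha) (eps_gt0 : 0 < eps).
Hypothesis bca : BCA D lam1 lam2 alpha eps f u v w Lam.
Hypotheses (c_gt0 : 0 < c) (w_ge : forall k i, c <= w k 0 i).
Hypothesis alpha_gt : Num.sqrt 2 * lam2 / (c ^+ 2 * eps) < alpha.

Let w_gt0 k i : 0 < w k 0 i. Proof. exact: lt_le_trans (w_ge k i). Qed.

Lemma BCA_v_ge k i : eps <= v k.+1 0 i.
Proof. by rewrite (BCA_v bca) le_max lexx. Qed.

Let v_gt0 k i : 0 < v k.+1 0 i. Proof. exact: lt_le_trans (BCA_v_ge k i). Qed.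

Lemma BCA_Lam_coord k i :
  Lam k.+1 0 i = Lam k 0 i + alpha * (v k.+1 0 i * w k.+1 0 i - u k.+1 0 i).
Proof. by rewrite (BCA_Lam bca) !mxE. Qed.

Lemma BCA_residual k i : v k.+1 0 i * w k.+1 0 i
  = u k.+1 0 i + alpha^-1 * (Lam k.+1 0 i - Lam k 0 i).
Proof. by rewrite BCA_Lam_coord; field; rewrite gt_eqF. Qed.

(** The w-update is the positive root of the quadratic equation
    alpha (v w^2 - a w) = lam2, with a = u - Lam / alpha for the old multiplier Lam,
    and the new multiplier is alpha (v w - a). *)
Lemma BCA_Lam_w k i : Lam k.+1 0 i * w k.+1 0 i = lam2.
Proof.
set V := v k.+1 0 i; set a := u k.+1 0 i - Lam k 0 i / alpha.
have V0 : 0 < V by exact: v_gt0.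
set s := Num.sqrt (a ^+ 2 + 4 * lam2 * V / alpha).
have s2 : s ^+ 2 = a ^+ 2 + 4 * lam2 * V / alpha.
  by rewrite sqr_sqrtr// addr_ge0 ?sqr_ge0// divr_ge0 ?mulr_ge0 ?ltW.
have wE : w k.+1 0 i = (2 * V)^-1 * (a + s) by rewrite (BCA_w bca).
have -> : Lam k.+1 0 i * w k.+1 0 i = alpha * (s ^+ 2 - a ^+ 2) / (4 * V).
  rewrite BCA_Lam_coord -/V wE.
  have -> : Lam k 0 i = alpha * (u k.+1 0 i - a).
    by rewrite /a; field; rewrite gt_eqF.
  by field; rewrite gt_eqF.
by rewrite s2; field; rewrite !gt_eqF.
Qed.

Lemma BCA_u_subgradient k (y : 'rV[R]_n) :
  TV D (u k.+1) + alpha * (\sum_i (v k 0 i * w k 0 i + Lam k 0 i / alpha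
       - lam2 / alpha - u k.+1 0 i) * (y 0 i - u k.+1 0 i)) <= TV D y.
Proof.
have := argmin_TV_subgradient (BCA_u bca k) y.
by under eq_bigr do rewrite !mxE [alpha^-1 * _]mulrC.
Qed.

(** The v-update is the projection onto the half-line from eps of the zero of an
    increasing affine function. In this form the update passes to the limit. *)
Lemma BCA_v_variational k i (y : R) : eps <= y ->
  0 <= ((lam1 + alpha * w k 0 i ^+ 2) * v k.+1 0 i
        - (lam1 * f 0 i + lam2 * ln (w k 0 i) + alpha * (w k 0 i * u k.+1 0 i)))
       * (y - v k.+1 0 i).
Proof.
move=> ey; rewrite (BCA_v bca); set N := _ + _ + _; set d := lam1 + _.
have d0 : 0 < d by rewrite addr_gt0// mulr_gt0// exprn_gt0.
have [Ne|eN] := leP (N / d) eps.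
  rewrite mulr_ge0 ?subr_ge0//.
  by rewrite mulrC -ler_pdivrMr.
by rewrite mulrCA divff ?gt_eqF// mulr1 subrr mul0r.
Qed.

(** Multipliers are lam2 / w, and the derivative of 1 / w is at most
    1 / c^2 in absolute value for w >= c. *)
Lemma BCA_Lam_lipschitz k i :
  (Lam k.+2 0 i - Lam k.+1 0 i) ^+ 2
    <= (lam2 / c ^+ 2) ^+ 2 * (w k.+2 0 i - w k.+1 0 i) ^+ 2.
Proof.
set w0 := w k.+1 0 i; set w1 := w k.+2 0 i.
have -> : Lam k.+1 0 i = lam2 / w0 by rewrite -(BCA_Lam_w k i) mulfK ?gt_eqF.
have -> : Lam k.+2 0 i = lam2 / w1 by rewrite -(BCA_Lam_w k.+1 i) mulfK ?gt_eqF.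
have w0_gt0 : 0 < w0 by exact: w_gt0.
have w1_gt0 : 0 < w1 by exact: w_gt0.
have -> : (lam2 / w1 - lam2 / w0) ^+ 2
    = (lam2 / (w0 * w1)) ^+ 2 * (w1 - w0) ^+ 2.
  by field; rewrite !gt_eqF.
have cw : c ^+ 2 <= w0 * w1.
  by rewrite expr2; apply: ler_pM; rewrite ?(ltW c_gt0)// w_ge.
have le : lam2 / (w0 * w1) <= lam2 / c ^+ 2.
  by rewrite ler_pM2l// lef_pV2 ?posrE ?mulr_gt0 ?exprn_gt0.
have ge0 : 0 <= lam2 / (w0 * w1) by rewrite ltW// divr_gt0 ?mulr_gt0.
rewrite ler_wpM2r ?sqr_ge0// ler_sqr ?nnegrE//; exact: le_trans le.
Qed.

(** The augmented Lagrangian along the iterates, starting with the first one: the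
    initial datum may violate v >= eps, and its multiplier 0 does not satisfy
    Lam w = lam2. *)
Definition energy k : R := \sum_i augLag_coord lam1 lam2 alpha (f 0 i)
    (u k.+1 0 i) (v k.+1 0 i) (w k.+1 0 i) (Lam k.+1 0 i) + TV D (u k.+1).

(** Modulus of decrease of the w-step, minus the Lipschitz bound on the ascent
    of the multiplier step. *)
Definition w_decrease : R := alpha / 2 * eps ^+ 2 - (lam2 / c ^+ 2) ^+ 2 / alpha.

Lemma w_decrease_gt0 : 0 < w_decrease.
Proof.
have ce : 0 < c ^+ 2 * eps by rewrite mulr_gt0 ?exprn_gt0.
have root_lt : Num.sqrt 2 * lam2 < alpha * (c ^+ 2 * eps).
  by rewrite -ltr_pdivrMr.
have root_ge0 : 0 <= Num.sqrt 2 * lam2 by rewrite mulr_ge0 ?sqrtr_ge0// ltW.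
have : (Num.sqrt 2 * lam2) ^+ 2 < (alpha * (c ^+ 2 * eps)) ^+ 2.
  by rewrite ltr_sqr ?nnegrE// (le_trans root_ge0)// ltW.
rewrite [ltLHS]exprMn sqr_sqrtr// => lt.
have -> : w_decrease
    = ((alpha * (c ^+ 2 * eps)) ^+ 2 - 2 * lam2 ^+ 2) / (2 * alpha * (c ^+ 2) ^+ 2).
  by rewrite /w_decrease; field; rewrite !gt_eqF.
by rewrite divr_gt0 ?subr_gt0// !mulr_gt0// !exprn_gt0.
Qed.

(** Sum of the four elementary steps, pixel by pixel: the subgradient inequality
    of the total variation cancels the linear term of the u-step, the slope of the
    v-step is nonnegative by the variational inequality, and the multiplier step
    raises the energy by the square of the multiplier increment over alpha. *)
Lemma energy_descent k :
  energy k.+1 + \sum_i (alpha / 2 * (u k.+2 0 i - u k.+1 0 i) ^+ 2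
    + lam1 / 2 * (v k.+2 0 i - v k.+1 0 i) ^+ 2
    + w_decrease * (w k.+2 0 i - w k.+1 0 i) ^+ 2) <= energy k.
Proof.
have sub := BCA_u_subgradient k.+1 (u k.+1).
rewrite /energy addrAC -big_split/=.
set z := fun i => v k.+1 0 i * w k.+1 0 i + Lam k.+1 0 i / alpha
       - lam2 / alpha - u k.+2 0 i.
apply: le_trans (_ : _ <= \sum_i (augLag_coord lam1 lam2 alpha (f 0 i)
   (u k.+1 0 i) (v k.+1 0 i) (w k.+1 0 i) (Lam k.+1 0 i)
   + alpha * (z i * (u k.+1 0 i - u k.+2 0 i))) + TV D (u k.+2)) _; last first.
  by rewrite big_split/= -mulr_sumr; move: sub; rewrite -/(z _); lra.
rewrite lerD2r; apply: ler_sum => i _.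
have step_u := augLag_coord_u lam1 lam2 alpha_gt0 (f 0 i) (u k.+1 0 i) (u k.+2 0 i)
  (v k.+1 0 i) (w k.+1 0 i) (Lam k.+1 0 i).
have := augLag_coord_v lam1 lam2 alpha (f 0 i) (u k.+2 0 i) (v k.+1 0 i)
  (v k.+2 0 i) (w k.+1 0 i) (Lam k.+1 0 i).
rewrite BCA_Lam_w subrr addr0 => step_v.
have opt_w : (Lam k.+1 0 i + alpha * (v k.+2 0 i * w k.+2 0 i - u k.+2 0 i))
    * w k.+2 0 i = lam2 by rewrite -BCA_Lam_coord BCA_Lam_w.
have step_w := augLag_coord_w lam1 (f 0 i) (ltW lam2_gt0)
  (ltW (v_gt0 k.+1 i)) (w_gt0 k.+1 i) (w_gt0 k.+2 i) opt_w.
have := augLag_coord_Lam lam1 lam2 alpha (f 0 i) (u k.+2 0 i) (v k.+2 0 i)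
  (w k.+2 0 i) (Lam k.+1 0 i) (Lam k.+2 0 i).
rewrite BCA_residual [_ + alpha^-1 * _]addrC addrK mulrCA -expr2 => step_Lam.
have VI := BCA_v_variational k.+1 i (BCA_v_ge k i).
have curv_v : 0 <= alpha / 2 * w k.+1 0 i ^+ 2 * (v k.+1 0 i - v k.+2 0 i) ^+ 2.
  by rewrite mulr_ge0 ?sqr_ge0// mulr_ge0 ?sqr_ge0// divr_ge0// ltW.
have curv_w : alpha / 2 * eps ^+ 2 * (w k.+1 0 i - w k.+2 0 i) ^+ 2
    <= alpha / 2 * v k.+2 0 i ^+ 2 * (w k.+1 0 i - w k.+2 0 i) ^+ 2.
  rewrite ler_wpM2r ?sqr_ge0// ler_pM2l ?divr_gt0//.
  by rewrite ler_sqr ?nnegrE ?(ltW eps_gt0) ?(ltW (v_gt0 _ _))// BCA_v_ge.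
have dual : alpha^-1 * (Lam k.+2 0 i - Lam k.+1 0 i) ^+ 2
    <= alpha^-1 * ((lam2 / c ^+ 2) ^+ 2 * (w k.+2 0 i - w k.+1 0 i) ^+ 2).
  by rewrite ler_pM2l ?invr_gt0// BCA_Lam_lipschitz.
rewrite /w_decrease /z; move: (lam2 / c ^+ 2) dual => q dual.
lra.
Qed.

(** Minus this constant bounds each pixel term from below along the iterates. *)
Definition coord_floor : R :=
  lam2 * eps + lam2 ^+ 2 * (c^-1 + 1) ^+ 2 / (2 * alpha).

Lemma energy_coord_coercive k i :
  lam1 / 2 * (f 0 i - v k.+1 0 i) ^+ 2 + lam2 * eps / 2 * w k.+1 0 i
  <= augLag_coord lam1 lam2 alpha (f 0 i)
       (u k.+1 0 i) (v k.+1 0 i) (w k.+1 0 i) (Lam k.+1 0 i) + coord_floor.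
Proof.
apply: augLag_coord_coercive => //; [exact: BCA_v_ge|exact: BCA_Lam_w].
Qed.

Let coercive_ge0 k i :
  0 <= lam1 / 2 * (f 0 i - v k.+1 0 i) ^+ 2 + lam2 * eps / 2 * w k.+1 0 i.
Proof.
by do ?[exact: sqr_ge0|exact: ltW|apply: addr_ge0|apply: mulr_ge0|rewrite invr_ge0].
Qed.

Lemma energy_ge k : - (\sum_(i < n) coord_floor) <= energy k.
Proof.
rewrite /energy -[leLHS]addr0 lerD ?TV_ge0// -sumrN; apply: ler_sum => i _.
by rewrite -subr_ge0 opprK (le_trans (coercive_ge0 k i))// energy_coord_coercive.
Qed.

Lemma decrease_ge0 k i : 0 <= alpha / 2 * (u k.+2 0 i - u k.+1 0 i) ^+ 2
    + lam1 / 2 * (v k.+2 0 i - v k.+1 0 i) ^+ 2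
    + w_decrease * (w k.+2 0 i - w k.+1 0 i) ^+ 2.
Proof.
have kappa := w_decrease_gt0.
by do ?[exact: sqr_ge0|exact: ltW|apply: addr_ge0|apply: mulr_ge0|rewrite invr_ge0].
Qed.

Lemma energy_le0 k : energy k <= energy 0.
Proof.
elim: k => // k; apply: le_trans; apply: le_trans (energy_descent k).
by rewrite lerDl sumr_ge0// => i _; exact: decrease_ge0.
Qed.

(** All pixel terms raised by the constant are nonnegative, so each of them is
    at most their sum, which the initial energy controls. *)
Lemma energy_coord_bounded k i :
  lam1 / 2 * (f 0 i - v k.+1 0 i) ^+ 2 + lam2 * eps / 2 * w k.+1 0 i
  <= energy 0 + \sum_(i < n) coord_floor.
Proof.
pose e i := augLag_coord lam1 lam2 alpha (f 0 i)
  (u k.+1 0 i) (v k.+1 0 i) (w k.+1 0 i) (Lam k.+1 0 i).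
have : \sum_i (e i + coord_floor) <= energy 0 + \sum_(i < n) coord_floor.
  rewrite big_split/= lerD2r; apply: le_trans (energy_le0 k).
  by rewrite lerDl TV_ge0.
apply: le_trans; rewrite (bigD1 i)//=.
apply: le_trans (energy_coord_coercive k i) _; rewrite lerDl.
apply: sumr_ge0 => j _.
exact: le_trans (coercive_ge0 k j) (energy_coord_coercive k j).
Qed.

(** The energy bounds v through the data term and w through the linear term;
    Lam is at most lam2 / c, and u is v w minus a multiplier increment over
    alpha. *)
Lemma BCA_bounded : exists M, forall k i, [/\ `|u k.+1 0 i| <= M,
  `|v k.+1 0 i| <= M, `|w k.+1 0 i| <= M & `|Lam k.+1 0 i| <= M].
Proof.
set C := energy 0 + \sum_(i < n) coord_floor.
pose F := \sum_i `|f 0 i|.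
pose Mv := F + (1 + C / (lam1 / 2)); pose Mw := C / (lam2 * eps / 2).
pose ML := lam2 / c; pose Mu := Mv * Mw + alpha^-1 * (ML + ML).
have l1 : 0 < lam1 / 2 by rewrite divr_gt0.
have le2 : 0 < lam2 * eps / 2 by rewrite divr_gt0// mulr_gt0.
have bv k i : `|v k.+1 0 i| <= Mv.
  have fF : `|f 0 i| <= F by rewrite /F (bigD1 i)//= lerDl sumr_ge0.
  have q : (f 0 i - v k.+1 0 i) ^+ 2 <= C / (lam1 / 2).
    rewrite ler_pdivlMr// mulrC; apply: le_trans (energy_coord_bounded k i).
    by rewrite lerDl mulr_ge0 ?(ltW le2)// ltW.
  have -> : v k.+1 0 i = f 0 i - (f 0 i - v k.+1 0 i) by rewrite subKr.
  apply: le_trans (ler_normB _ _) _; apply: lerD => //.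
  set x := f 0 i - _ in q *.
  have := sqr_ge0 (`|x| - 1); rewrite sqrrB1 real_normK ?num_real//.
  rewrite mulr2n; have := normr_ge0 x; lra.
have bw k i : `|w k.+1 0 i| <= Mw.
  rewrite gtr0_norm// ler_pdivlMr// mulrC.
  apply: le_trans (energy_coord_bounded k i).
  by rewrite lerDr mulr_ge0 ?sqr_ge0// ltW.
have bL k i : `|Lam k 0 i| <= ML.
  case: k => [|k].
    by rewrite (BCA_Lam0 bca) mxE normr0 divr_ge0 ?ltW.
  have -> : Lam k.+1 0 i = lam2 / w k.+1 0 i.
    by rewrite -(BCA_Lam_w k i) mulfK ?gt_eqF.
  rewrite gtr0_norm ?divr_gt0// ler_pM2l// lef_pV2 ?posrE//; exact: w_ge.
have bu k i : `|u k.+1 0 i| <= Mu.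
  have -> : u k.+1 0 i
      = v k.+1 0 i * w k.+1 0 i - alpha^-1 * (Lam k.+1 0 i - Lam k 0 i).
    by rewrite BCA_residual addrK.
  apply: le_trans (ler_normB _ _) _; apply: lerD.
    by rewrite normrM ler_pM.
  rewrite normrM gtr0_norm ?invr_gt0// ler_pM2l ?invr_gt0//.
  by apply: le_trans (ler_normB _ _) _; apply: lerD.
exists (Num.max (Num.max Mu Mv) (Num.max Mw ML)) => k i.
by split; rewrite !le_max ?bu ?bv ?bw ?bL ?orbT.
Qed.

Let diff_cvg0 (x : nat -> 'rV[R]_n) (a : R) : 0 < a ->
  (forall k i, a * (x k.+2 0 i - x k.+1 0 i) ^+ 2 <=
     alpha / 2 * (u k.+2 0 i - u k.+1 0 i) ^+ 2
     + lam1 / 2 * (v k.+2 0 i - v k.+1 0 i) ^+ 2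
     + w_decrease * (w k.+2 0 i - w k.+1 0 i) ^+ 2) ->
  x k.+1 - x k @[k --> \oo] --> (0 : 'rV[R]_n).
Proof.
move=> a0 ax; apply/cvg_rVP => i; rewrite mxE.
have : x k.+2 0 i - x k.+1 0 i @[k --> \oo] --> 0.
  apply: (cvg0_of_descent energy_ge a0) => k.
  apply: le_trans (energy_descent k); rewrite lerD2l.
  apply: le_trans (ax k i) _; rewrite [leRHS](bigD1 i)//= lerDl.
  by apply: sumr_ge0 => j _; exact: decrease_ge0.
rewrite (cvg_shiftS (fun k => x k.+1 0 i - x k 0 i)); apply: cvg_trans.
by apply: near_eq_cvg; apply: nearW => k; rewrite !mxE.
Qed.

(** The increments of u, v and w appear in the energy decrease; that of Lam is
    dominated by that of w. *)
Lemma BCA_diff_cvg0 :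
  [/\ (u k.+1 - u k @[k --> \oo] --> (0 : 'rV[R]_n)),
      (v k.+1 - v k @[k --> \oo] --> (0 : 'rV[R]_n)),
      (w k.+1 - w k @[k --> \oo] --> (0 : 'rV[R]_n)) &
      (Lam k.+1 - Lam k @[k --> \oo] --> (0 : 'rV[R]_n))].
Proof.
have a2 : 0 < alpha / 2 by rewrite divr_gt0.
have l2 : 0 < lam1 / 2 by rewrite divr_gt0.
have U k i : 0 <= alpha / 2 * (u k.+2 0 i - u k.+1 0 i) ^+ 2.
  by rewrite mulr_ge0 ?sqr_ge0 ?(ltW a2).
have V k i : 0 <= lam1 / 2 * (v k.+2 0 i - v k.+1 0 i) ^+ 2.
  by rewrite mulr_ge0 ?sqr_ge0 ?(ltW l2).
have W k i : 0 <= w_decrease * (w k.+2 0 i - w k.+1 0 i) ^+ 2.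
  by rewrite mulr_ge0 ?sqr_ge0 ?(ltW w_decrease_gt0).
split.
- apply: (diff_cvg0 a2) => k i; have := V k i; have := W k i; lra.
- apply: (diff_cvg0 l2) => k i; have := U k i; have := W k i; lra.
- apply: (diff_cvg0 w_decrease_gt0) => k i; have := U k i; have := V k i; lra.
- have L0 : 0 < (lam2 / c ^+ 2) ^+ 2 by rewrite exprn_gt0// divr_gt0 ?exprn_gt0.
  apply: (@diff_cvg0 _ (w_decrease / (lam2 / c ^+ 2) ^+ 2)) => [|k i].
    by rewrite divr_gt0// w_decrease_gt0.
  apply: le_trans (_ : _ <= w_decrease * (w k.+2 0 i - w k.+1 0 i) ^+ 2) _.
    rewrite -mulrA ler_pM2l ?w_decrease_gt0// ler_pdivrMl//.
    exact: BCA_Lam_lipschitz.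
  have := U k i; have := V k i; lra.
Qed.

Lemma BCA_limit_point_exists :
  exists us vs ws Lams, subseq_limit u v w Lam us vs ws Lams.
Proof.
have [M bM] := BCA_bounded.
pose x (j : ('I_n + 'I_n) + ('I_n + 'I_n)) k := match j with
  | inl (inl i) => u k.+1 0 i | inl (inr i) => v k.+1 0 i
  | inr (inl i) => w k.+1 0 i | inr (inr i) => Lam k.+1 0 i end.
have [j k|phi iphi xc] := @bolzano_weierstrass_finite R _ x M.
  by case: j => [[|]|[|]] i; have [] := bM k i.
exists (\row_i limn (x (inl (inl i)) \o phi)), (\row_i limn (x (inl (inr i)) \o phi)),
  (\row_i limn (x (inr (inl i)) \o phi)), (\row_i limn (x (inr (inr i)) \o phi)).
(* the bounds hold from index 1 on, hence the shift *)
exists (S \o phi); first by move=> m k /=; rewrite leEnat ltnS -leEnat iphi.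
by split; apply/cvg_rVP => i; rewrite mxE; exact: xc.
Qed.

(** The increments tend to 0, so the subsequence shifted by one has the same
    limits. The u- and v-updates mix iterates k and k + 1, which therefore merge in
    the limit. *)
Lemma BCA_limit_point_optimal us vs ws Lams :
  subseq_limit u v w Lam us vs ws Lams ->
  optimality_system D lam1 lam2 eps f us vs ws Lams.
Proof.
move=> [phi iphi [ul vl wl Ll]]; have [du dv dw dL] := BCA_diff_cvg0.
have next (x : nat -> 'rV[R]_n) (l : 'rV[R]_n) : x k.+1 - x k @[k --> \oo] --> (0 : 'rV[R]_n) ->
    x (phi j) @[j --> \oo] --> l -> x (phi j).+1 @[j --> \oo] --> l.
  move=> dx xl; have dxphi := cvg_comp _ _ (increasing_seq_cvgoo iphi) dx.
  rewrite (_ : (fun j => _) = fun j => x (phi j).+1 - x (phi j) + x (phi j)).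
    by rewrite -[l]add0r; exact: (cvgD dxphi xl).
  by apply/funext => j; rewrite subrK.
have un := next _ _ du ul; have vn := next _ _ dv vl.
have wn := next _ _ dw wl; have Ln := next _ _ dL Ll.
have coord (x : nat -> 'rV[R]_n) (l : 'rV[R]_n) := (cvg_rVP x l).1.
have wi := coord _ _ wl; have Li := coord _ _ Ll; have vi := coord _ _ vl.
have uni := coord _ _ un; have vni := coord _ _ vn.
have wni := coord _ _ wn; have Lni := coord _ _ Ln.
have ws_gt0 i : 0 < ws 0 i.
  apply: lt_le_trans c_gt0 _; apply: cvgr_to_ge (wi i) _.
  by apply: nearW => j; exact: w_ge.
have feas i : vs 0 i * ws 0 i = us 0 i.
  have vw : v (phi j).+1 0 i * w (phi j).+1 0 i @[j --> \oo] --> vs 0 i * ws 0 i.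
    exact: cvgM.
  have uL : u (phi j).+1 0 i + alpha^-1 * (Lam (phi j).+1 0 i - Lam (phi j) 0 i)
      @[j --> \oo] --> us 0 i + alpha^-1 * (Lams 0 i - Lams 0 i).
    by apply: cvgD => //; apply: cvgM; [exact: cvg_cst|exact: cvgB].
  rewrite subrr mulr0 addr0 in uL.
  by apply: cvgn_unique vw uL => j; exact: BCA_residual.
split=> //.
- move=> i; apply: cvgr_to_ge (vni i) _.
  by apply: nearW => j; exact: BCA_v_ge.
- move=> i.
  have LW : Lam (phi j).+1 0 i * w (phi j).+1 0 i @[j --> \oo] --> Lams 0 i * ws 0 i.
    exact: cvgM.
  apply: cvgn_unique LW (cvg_cst lam2) => j; exact: BCA_Lam_w.
- move=> y.
  have TVl := @TV_cvg _ _ D _ _ un.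
  have lim : TV D (u (phi j).+1) + alpha * (\sum_i
      (v (phi j) 0 i * w (phi j) 0 i + Lam (phi j) 0 i / alpha
       - lam2 / alpha - u (phi j).+1 0 i) * (y 0 i - u (phi j).+1 0 i))
      @[j --> \oo] --> TV D us + alpha * (\sum_i
      (vs 0 i * ws 0 i + Lams 0 i / alpha
       - lam2 / alpha - us 0 i) * (y 0 i - us 0 i)).
    apply: cvgD => //; apply: cvgM; first exact: cvg_cst.
    apply: cvg_big => [|i _]; first exact: add_continuous.
    apply: cvgM; last by apply: cvgB => //; exact: cvg_cst.
    apply: cvgB => //; apply: cvgB; last exact: cvg_cst.
    apply: cvgD; first exact: cvgM.
    by apply: cvgM => //; exact: cvg_cst.
  apply: le_trans (_ : _ <= TV D us + alpha * (\sum_i (vs 0 i * ws 0 i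
       + Lams 0 i / alpha - lam2 / alpha - us 0 i) * (y 0 i - us 0 i))) _; last first.
    by apply: cvgr_to_le lim _; apply: nearW => j; exact: BCA_u_subgradient.
  rewrite lerD2l mulr_sumr le_eqVlt; apply/orP; left.
  by apply/eqP; apply: eq_bigr => i _; rewrite feas; field; rewrite gt_eqF.
- move=> i y ey.
  have lnl : ln (w (phi j) 0 i) @[j --> \oo] --> ln (ws 0 i).
    exact: continuous_cvg (continuous_ln (ws_gt0 i)) (wi i).
  have lim : ((lam1 + alpha * w (phi j) 0 i ^+ 2) * v (phi j).+1 0 i
        - (lam1 * f 0 i + lam2 * ln (w (phi j) 0 i)
           + alpha * (w (phi j) 0 i * u (phi j).+1 0 i)))
       * (y - v (phi j).+1 0 i) @[j --> \oo] -->
      ((lam1 + alpha * ws 0 i ^+ 2) * vs 0 i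
        - (lam1 * f 0 i + lam2 * ln (ws 0 i) + alpha * (ws 0 i * us 0 i)))
       * (y - vs 0 i).
    have cst (a : R) : a @[j --> \oo] --> a by exact: cvg_cst.
    apply: cvgM; last exact: cvgB.
    apply: cvgB.
      apply: cvgM => //; apply: cvgD => //; apply: cvgM => //.
      by rewrite expr2; apply: cvgM.
    apply: cvgD; first by apply: cvgD => //; apply: cvgM.
    by apply: cvgM => //; apply: cvgM.
  suff -> : lam1 * (vs 0 i - f 0 i) - lam2 * ln (ws 0 i)
    = (lam1 + alpha * ws 0 i ^+ 2) * vs 0 i
      - (lam1 * f 0 i + lam2 * ln (ws 0 i) + alpha * (ws 0 i * us 0 i)).
    by apply: cvgr_to_ge lim _; apply: nearW => j; exact: BCA_v_variational.
  by rewrite -feas; ring.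
Qed.

End BlockCoordinateDescent.

Unset Implicit Arguments.
Set Strict Implicit.
Set Printing Implicit Defensive.

Theorem theorem1 (R : realType) (n : nat)
    (D : {linear 'rV[R]_n -> 'M[R]_(n, 2)})
    (lam1 lam2 alpha eps : R) (f : 'rV[R]_n)
    (u v w Lam : nat -> 'rV[R]_n) (c : R)
    (lam1_gt0 : 0 < lam1) (lam2_gt0 : 0 < lam2)
    (alpha_gt0 : 0 < alpha) (eps_gt0 : 0 < eps)
    (uvwLam : BCA D lam1 lam2 alpha eps f u v w Lam)
    (c_gt0 : 0 < c) (w_ge : forall k i, c <= w k 0 i)
    (alpha_gt : Num.max (Num.sqrt 2 * lam2 / (c ^+ 2 * eps))
                        (lam2 * (c^-1 - 1) ^+ 2) < alpha) :
  ((exists M : R, forall k, [/\ norm2 (u k) <= M, norm2 (v k) <= M,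
                                norm2 (w k) <= M & norm2 (Lam k) <= M]) /\
   (exists us vs ws Lams, subseq_limit u v w Lam us vs ws Lams)) /\
  [/\ (u k.+1 - u k @[k --> \oo] --> (0 : 'rV[R]_n)),
      (v k.+1 - v k @[k --> \oo] --> (0 : 'rV[R]_n)),
      (w k.+1 - w k @[k --> \oo] --> (0 : 'rV[R]_n)) &
      (Lam k.+1 - Lam k @[k --> \oo] --> (0 : 'rV[R]_n))] /\
  (forall us vs ws Lams, subseq_limit u v w Lam us vs ws Lams ->
     stationary_augLag D lam1 lam2 alpha eps f us vs ws Lams /\
     stationary_TVIC D lam1 lam2 eps f us vs).
Proof.
have alpha_gt' : Num.sqrt 2 * lam2 / (c ^+ 2 * eps) < alpha.
  by apply: le_lt_trans alpha_gt; rewrite le_max lexx.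
split; last split.
- split; last exact: (BCA_limit_point_exists lam1_gt0 lam2_gt0 alpha_gt0 eps_gt0
    uvwLam c_gt0 w_ge alpha_gt').
  have [M bM] := BCA_bounded lam1_gt0 lam2_gt0 alpha_gt0 eps_gt0 uvwLam c_gt0
    w_ge alpha_gt'.
  have [Mu bu] : exists B, forall k, norm2 (u k) <= B.
    by apply: (@norm2_bounded _ _ _ M) => k i; have [] := bM k i.
  have [Mv bv] : exists B, forall k, norm2 (v k) <= B.
    by apply: (@norm2_bounded _ _ _ M) => k i; have [] := bM k i.
  have [Mw bw] : exists B, forall k, norm2 (w k) <= B.
    by apply: (@norm2_bounded _ _ _ M) => k i; have [] := bM k i.
  have [ML bL] : exists B, forall k, norm2 (Lam k) <= B.
    by apply: (@norm2_bounded _ _ _ M) => k i; have [] := bM k i.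
  exists (Num.max (Num.max Mu Mv) (Num.max Mw ML)) => k.
  by split; rewrite !le_max ?bu ?bv ?bw ?bL ?orbT.
- exact: (BCA_diff_cvg0 lam1_gt0 lam2_gt0 alpha_gt0 eps_gt0 uvwLam c_gt0 w_ge alpha_gt').
- move=> us vs ws Lams lim.
  have opt := BCA_limit_point_optimal lam1_gt0 lam2_gt0 alpha_gt0 eps_gt0 uvwLam
    c_gt0 w_ge alpha_gt' lim.
  split; first exact: (augLag_stationary lam1_gt0 alpha_gt0 opt).
  exact: (TVIC_stationary lam1_gt0 lam2_gt0 eps_gt0 opt).
Qed.
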